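(* Let $Q\in\mathbb{R}^{n\times n}$ be symmetric, positive definite and strictly block diagonally dominant relative to $p=[n_1,\dots,n_N]^T$. Let $q^*\in(0,1)$. For each $i\in[N]$ let $$q_i=\frac{2\sum_{j\ne i}\|Q^{[i]}_j\|_2+\lambda_{\max}(Q^{[i]}_i)-\lambda_{\min}(Q^{[i]}_i)}{\lambda_{\max}(Q^{[i]}_i)+\lambda_{\min}(Q^{[i]}_i)}.$$ If for all $i\in[N]$ agent $i$ chooses $$\gamma_i=\frac{2}{\lambda_{\max}(Q^{[i]}_i)+\lambda_{\min}(Q^{[i]}_i)+2\alpha_i},$$ where $$\alpha_i=\max\left\{\left(\frac{q_i}{q^*}-1\right)\left(\frac{\lambda_{\max}(Q^{[i]}_i)+\lambda_{\min}(Q^{[i]}_i)}{2}\right),\,0\right\},$$ then $q_A\le q^*$, where $q_A$ is the convergence parameter of the regularized problem with $A=\mathrm{diag}(\alpha_1I_{n_1},\dots,\alpha_NI_{n_N})$: $$q_A=\max_{i\in[N]}\Big(\big\|I-\gamma_i(Q+A)^{[i]}_i\big\|_2+\gamma_i\sum_{j\ne i}\big\|(Q+A)^{[i]}_j\big\|_2\Big).$$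
   Context: Notation: $[N]=\{1,\dots,N\}$, $n_i\ge1$, $n=\sum_{i=1}^Nn_i$. A matrix $B\in\mathbb{R}^{n\times n}$ is partitioned into blocks $B^{[i]}_j\in\mathbb{R}^{n_i\times n_j}$, $i,j\in[N]$. $\|\cdot\|_2$ is the induced 2-norm. $B$ is strictly block diagonally dominant relative to $p$ if every $B^{[i]}_i$ is nonsingular and $\big(\|(B^{[i]}_i)^{-1}\|_2\big)^{-1}>\sum_{j\ne i}\|B^{[i]}_j\|_2$ for all $i\in[N]$. $q_i$ is the unregularized convergence parameter $\|I-\gamma Q^{[i]}_i\|_2+\gamma\sum_{j\ne i}\|Q^{[i]}_j\|_2$ of block $i$ evaluated at the stepsize $\gamma=2/(\lambda_{\max}(Q^{[i]}_i)+\lambda_{\min}(Q^{[i]}_i))$. *)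

(* Defs.v *)
From mathcomp Require Import all_boot all_order all_algebra.
From mathcomp Require Import boolp classical_sets reals.

Set Implicit Arguments.
Unset Strict Implicit.
Unset Printing Implicit Defensive.

Import Order.TTheory GRing.Theory Num.Theory.
Local Open Scope classical_set_scope.
Local Open Scope ring_scope.

Definition norm2 (R : realType) (n : nat) (x : 'cV[R]_n) : R :=
  Num.sqrt (\sum_(i < n) x i ord0 ^+ 2).

Definition opnorm2 (R : realType) (m n : nat) (B : 'M[R]_(m, n)) : R :=
  sup [set norm2 (B *m x) / norm2 x | x in [set x : 'cV[R]_n | x != 0]].

(* A matrix has finitely many eigenvalues, so the supremum and infimum below
   are a maximum and a minimum as soon as there is a real eigenvalue, e.g. for
   a symmetric matrix of positive size. *)
Definition lambda_max (R : realType) (n : nat) (B : 'M[R]_n) : R :=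
  sup [set a : R | eigenvalue B a].

Definition lambda_min (R : realType) (n : nat) (B : 'M[R]_n) : R :=
  inf [set a : R | eigenvalue B a].

Definition posdefmx (R : realType) (n : nat) (B : 'M[R]_n) : Prop :=
  forall x : 'cV[R]_n, x != 0 -> 0 < (x^T *m B *m x) ord0 ord0.

(* The blocks B^[i]_j of a matrix partitioned relative to p = [p_0, p_1, ...]
   are [submxblock B i j]. *)
Definition offdiag_sum (R : realType) (N : nat) (p : 'I_N -> nat)
    (B : 'M[R]_(\sum_(i < N) p i)) (i : 'I_N) : R :=
  \sum_(j < N | j != i) opnorm2 (submxblock B i j).

Definition strict_block_diag_dominant (R : realType) (N : nat)
    (p : 'I_N -> nat) (B : 'M[R]_(\sum_(i < N) p i)) : Prop :=
  (forall i : 'I_N, submxblock B i i \in unitmx) /\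
  (forall i : 'I_N,
     (opnorm2 (invmx (submxblock B i i)))^-1 > offdiag_sum B i).

(* The maximum of a nonempty finite family: folding from one of its own values
   adds nothing to it. *)
Definition max_family (R : realType) (N : nat) (hN : (0 < N)%N)
    (f : 'I_N -> R) : R :=
  \big[Num.max/f (Ordinal hN)]_(i < N) f i.

Definition convergence_parameter (R : realType) (N : nat) (hN : (0 < N)%N)
    (p : 'I_N -> nat) (gamma : 'I_N -> R) (B : 'M[R]_(\sum_(i < N) p i)) : R :=
  max_family hN (fun i : 'I_N =>
    opnorm2 (1%:M - gamma i *: submxblock B i i)
      + gamma i * offdiag_sum B i).

(* Main.v *)
(* Write S for a diagonal block of Q, M and m for its extreme eigenvalues and a, g
   for alpha_i, gamma_i. Since g (M + m + 2a) = 2, the step matrix is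
   I - g (S + a I) = g ((M + m)/2 I - S), whose 2-norm is at most g (M - m)/2 by
   the spectral theorem. Adding the off-diagonal terms, which A does not change,
   bounds the i-th value by q_i (M + m)/(M + m + 2a), and a is the least
   nonnegative shift that makes this at most q^*. The spectral theorem for S is
   obtained from the one for its complexification. *)
Require Import Defs.
From mathcomp Require Import all_boot all_order all_algebra.
From mathcomp Require Import boolp classical_sets reals.
From mathcomp Require Import complex ring lra.

Set Implicit Arguments.
Unset Strict Implicit.
Unset Printing Implicit Defensive.

Import Order.TTheory GRing.Theory Num.Theory.
Local Open Scope ring_scope.
Local Open Scope complex_scope.

(** * Spectral theorem for real symmetric matrices *)

Lemma map_conjC_real (R : rcfType) m n (A : 'M[R]_(m, n)) :
  map_mx Num.conj (map_mx (real_complex R) A) = map_mx (real_complex R) A.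
Proof.
apply/matrixP => i j; rewrite !mxE; apply: conj_Creal.
by apply/complex_realP; exists (A i j).
Qed.

Lemma symmetricmxP (R : fieldType) n (A : 'M[R]_n) :
  reflect (A^T = A) (A \is symmetricmx).
Proof.
have eA : A = (-1) ^+ false *: map_mx idfun A^T <-> A^T = A.
  by rewrite expr0 scale1r map_mx_id //; split=> /esym.
by apply: (iffP (is_hermitianmxP _ _ _)) => /eA.
Qed.

(** The complexification is Hermitian, hence unitarily diagonalizable with real spectrum. The matrix
    [P] may stay complex, because eigenvalues and norms can be compared after embedding into
    [R[i]]. *)
Lemma symmetric_diagonalization (R : rcfType) n (S : 'M[R]_n) :
  S \is symmetricmx ->
  exists (P : 'M[R[i]]_n) (d : 'rV[R]_n),
    P \is unitarymx /\
    P *m map_mx (real_complex R) S = diag_mx (map_mx (real_complex R) d) *m P.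
Proof.
move=> /symmetricmxP Ssym; set SC := map_mx _ S.
have hS : SC \is hermsymmx.
  apply/is_hermitianmxP.
  by rewrite expr0 scale1r map_trmx Ssym map_conjC_real.
have /mxOverP dR := hermitian_spectral_diag_real hS.
exists (spectralmx SC), (map_mx (@complex.Re R) (spectral_diag SC)).
split; first exact: spectral_unitarymx.
have /orthomx_spectralP eS := hermitian_normalmx hS.
rewrite {2}eS mulmxA mulmxA mulmxV ?spectral_unit // mul1mx.
congr (diag_mx _ *m _); apply/rowP => j; rewrite !mxE.
by apply/esym/RRe_real.
Qed.

(** Being an eigenvalue is unaffected by the field extension, and [v] to [v *m invmx P] carries left
    eigenvectors of [S] to those of the diagonal matrix. *)
Lemma diagonalization_eigenvalueP (R : rcfType) n (S : 'M[R]_n)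
    (P : 'M[R[i]]_n) (d : 'rV[R]_n) (a : R) :
  P \is unitarymx ->
  P *m map_mx (real_complex R) S = diag_mx (map_mx (real_complex R) d) *m P ->
  reflect (exists i, a = d 0 i) (eigenvalue S a).
Proof.
move=> /unitarymx_unit Pu PS.
have -> : eigenvalue S a =
    eigenvalue (diag_mx (map_mx (real_complex R) d)) a%:C.
  rewrite -(eigenvalue_map (real_complex R)).
  apply/eigenvalueP/eigenvalueP => -[v hv v0].
  - exists (v *m invmx P).
      have -> : diag_mx (map_mx (real_complex R) d)
          = P *m map_mx (real_complex R) S *m invmx P by rewrite PS mulmxK.
      by rewrite !mulmxA mulmxKV // hv scalemxAl.
    apply: contraNneq v0 => v0; by rewrite -(mulmxKV Pu v) v0 mul0mx.
  - exists (v *m P); first by rewrite -mulmxA PS mulmxA hv scalemxAl.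
    apply: contraNneq v0 => v0; by rewrite -(mulmxK Pu v) v0 mul0mx.
apply: (iffP eigenvalueP) => [[v hv /rV0Pn[i vi]]|[i ->]].
- exists i; apply: complexI; apply: (mulfI vi).
  have /rowP/(_ i) := hv; rewrite mul_mx_diag !mxE => ->; exact: mulrC.
- exists (delta_mx 0 i).
    by rewrite -rowE row_diag_mx mxE.
  by apply/rV0Pn; exists i; rewrite mxE !eqxx oner_eq0.
Qed.

(** * Euclidean and operator norms *)

Lemma norm2_ge0 (R : realType) n (x : 'cV[R]_n) : 0 <= norm2 x.
Proof. exact: sqrtr_ge0. Qed.

Lemma norm2_sqr (R : realType) n (x : 'cV[R]_n) :
  norm2 x ^+ 2 = \sum_i x i 0 ^+ 2.
Proof. by rewrite sqr_sqrtr // sumr_ge0 // => i _; rewrite sqr_ge0. Qed.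

Lemma norm2_gt0 (R : realType) n (x : 'cV[R]_n) : x != 0 -> 0 < norm2 x.
Proof.
move=> /cV0Pn[i xi]; rewrite sqrtr_gt0 (bigD1 i) //=.
by rewrite ltr_pwDl ?exprn_even_gt0 // sumr_ge0 // => j _; rewrite sqr_ge0.
Qed.

(** Writing [u] for [P x], unitarity gives u^* u = x^T P^* P x = x^T x. *)
Lemma unitarymx_norm2 (R : realType) n (P : 'M[R[i]]_n) (x : 'cV[R]_n) :
  P \is unitarymx ->
  (norm2 x ^+ 2)%:C
    = \sum_i `|(P *m map_mx (real_complex R) x) i 0| ^+ 2.
Proof.
move=> Pu; set u := P *m _.
have Pu' : map_mx Num.conj P^T *m P = 1%:M.
  by rewrite -invmx_unitary // mulVmx ?unitarymx_unit.
have : (map_mx Num.conj u^T *m u) 0 0 = ((map_mx (real_complex R) x)^T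
    *m map_mx (real_complex R) x) 0 0.
  rewrite trmx_mul map_mxM /= mulmxA -[_ *m _ *m P]mulmxA Pu' mulmx1.
  by rewrite -map_trmx map_conjC_real.
rewrite !mxE norm2_sqr rmorph_sum /= => e.
transitivity (\sum_j map_mx Num.conj u^T 0 j * u j 0).
  by rewrite e; apply: eq_bigr => i _; rewrite !mxE expr2 rmorphM.
by apply: eq_bigr => i _; rewrite !mxE mulrC -normCK.
Qed.

(** In the coordinates [P x] the matrix c - S is diagonal with entries c - d_i of modulus at most
    [r], so the squared norms compare term by term. *)
Lemma norm2_shift_le (R : realType) n (S : 'M[R]_n) (c r : R) (x : 'cV[R]_n) :
  S \is symmetricmx -> 0 <= r ->
  (forall a, eigenvalue S a -> `|c - a| <= r) ->
  norm2 ((c%:M - S) *m x) <= r * norm2 x.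
Proof.
move=> /symmetric_diagonalization[P [d [Pu PS]]] r0 Hr.
rewrite -(ler_pXn2r (n := 2)) ?nnegrE ?mulr_ge0 ?norm2_ge0 // exprMn.
rewrite -lecR [leRHS]rmorphM /= !(unitarymx_norm2 _ Pu) mulr_sumr ler_sum // => i _.
rewrite map_mxM map_mxB map_scalar_mx /= mulmxA mulmxBr PS.
rewrite scalar_mxC -mulmxBl -mulmxA; set u := P *m _.
have -> : (((c%:C)%:M - diag_mx (map_mx (real_complex R) d)) *m u) i 0
    = (c - d 0 i)%:C * u i 0.
  by rewrite mulmxBl mul_scalar_mx mul_diag_mx !mxE rmorphB mulrBl.
rewrite normrM exprMn; apply: ler_wpM2r; first by rewrite exprn_ge0.
have -> : `|(c - d 0 i)%:C| ^+ 2 = (`|c - d 0 i| ^+ 2)%:C.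
  by rewrite -add_Re2_Im2 /= expr0n addr0 real_normK ?num_real.
rewrite lecR ler_pXn2r ?nnegrE //; apply: Hr.
by apply/(diagonalization_eigenvalueP _ Pu PS); exists i.
Qed.

Lemma opnorm2_le (R : realType) m n (B : 'M[R]_(m, n)) (r : R) :
  0 <= r -> (forall x, norm2 (B *m x) <= r * norm2 x) -> opnorm2 B <= r.
Proof.
move=> r0 Br; rewrite /opnorm2; set E := (X in sup X).
(* For [n] = 0 there is no nonzero vector: the supremum of the empty set is 0, and [r0]
   concludes. *)
have [E0|/set0P/negP/negbNE/eqP ->] := pselect (E !=set0)%classic; last first.
  by rewrite sup0.
apply: ge_sup => // _ [x /= x0 <-].
by rewrite ler_pdivrMr ?norm2_gt0.
Qed.

(** * Extreme eigenvalues *)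

Lemma eigenvalues_nonempty (R : realType) n (S : 'M[R]_n) :
  (0 < n)%N -> S \is symmetricmx -> ([set a | eigenvalue S a] !=set0)%classic.
Proof.
case: n S => // n S _ /symmetric_diagonalization[P [d [Pu PS]]].
exists (d 0 0) => /=; by apply/(diagonalization_eigenvalueP _ Pu PS); exists 0.
Qed.

(** This boundedness makes the [sup] and [inf] of the spectrum genuine bounds. *)
Lemma eigenvalue_bounded (R : realType) n (S : 'M[R]_n) :
  S \is symmetricmx -> exists b, forall a, eigenvalue S a -> `|a| <= b.
Proof.
move=> /symmetric_diagonalization[P [d [Pu PS]]].
exists (\sum_i `|d 0 i|) => a /(diagonalization_eigenvalueP _ Pu PS)[i ->].
by rewrite (bigD1 i) //= lerDl sumr_ge0.
Qed.

Lemma lambda_max_ge (R : realType) n (S : 'M[R]_n) (a : R) :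
  S \is symmetricmx -> eigenvalue S a -> a <= lambda_max S.
Proof.
move=> /eigenvalue_bounded[b Hb] Sa; apply: ub_le_sup => //.
by exists b => e /Hb; exact/le_trans/ler_norm.
Qed.

Lemma lambda_min_le (R : realType) n (S : 'M[R]_n) (a : R) :
  S \is symmetricmx -> eigenvalue S a -> lambda_min S <= a.
Proof.
move=> /eigenvalue_bounded[b Hb] Sa; apply: ge_inf => //.
by exists (- b) => e /Hb; rewrite ler_norml => /andP[].
Qed.

(** A left eigenvector satisfies v S v^T = a v v^T; the left side is positive and v v^T is
    nonnegative. *)
Lemma posdef_eigenvalue_gt0 (R : realType) n (S : 'M[R]_n) (a : R) :
  posdefmx S -> eigenvalue S a -> 0 < a.
Proof.
move=> Spos /eigenvalueP[v hv v0].
have vT0 : v^T != 0 by apply: contraNneq v0 => vT; rewrite -[v]trmxK vT trmx0.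
have := Spos _ vT0; rewrite trmxK hv -scalemxAl mxE.
suff h : 0 <= (v *m v^T) 0 0.
  move=> h'; rewrite ltNge; apply: contraTN h' => a0.
  by rewrite -leNgt mulr_le0_ge0.
by rewrite mxE sumr_ge0 // => i _; rewrite mxE -expr2 sqr_ge0.
Qed.

(** The submatrix is E^T B E, where the columns of [E] are the basis vectors indexed by [f].
    Injectivity gives E^T E = 1, so E x is nonzero when [x] is. *)
Lemma posdef_mxsub (R : realType) m n (f : 'I_m -> 'I_n) (B : 'M[R]_n) :
  injective f -> posdefmx B -> posdefmx (mxsub f f B).
Proof.
move=> f_inj Bpos x x0; pose E : 'M[R]_(n, m) := colsub f 1%:M.
have -> : mxsub f f B = E^T *m B *m E.
  by rewrite mulmx_colsub mulmx1 trmx_mxsub trmx1 mul_rowsub_mx mul1mx -mxsub_comp.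
have -> : x^T *m (E^T *m B *m E) *m x = (E *m x)^T *m B *m (E *m x).
  by rewrite trmx_mul !mulmxA.
apply: Bpos; apply: contraNneq x0 => Ex.
have <- : E^T *m (E *m x) = x.
  rewrite mulmxA trmx_mxsub trmx1 mul_rowsub_mx mul1mx -mxsub_comp.
  suff -> : mxsub f f 1%:M = 1%:M :> 'M[R]_m by rewrite mul1mx.
  by apply/matrixP => i j; rewrite !mxE (inj_eq f_inj).
by rewrite Ex mulmx0.
Qed.

Lemma symmetric_mxsub (R : fieldType) m n (f : 'I_m -> 'I_n) (B : 'M[R]_n) :
  B \is symmetricmx -> mxsub f f B \is symmetricmx.
Proof. by move=> /symmetricmxP Bs; apply/symmetricmxP; rewrite trmx_mxsub Bs. Qed.

Lemma submxblock_mxdiag_neq (V : nmodType) N (p : 'I_N -> nat)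
    (B : forall i, 'M[V]_(p i)) (i j : 'I_N) :
  i != j -> submxblock (\mxdiag_(k < N) B k) i j = 0.
Proof. by move=> /negPf ij; rewrite /mxdiag mxblockK ij. Qed.

Lemma lambda_min_le_max (R : realType) n (S : 'M[R]_n) :
  (0 < n)%N -> S \is symmetricmx -> lambda_min S <= lambda_max S.
Proof.
move=> n0 Ssym; have [a Sa] := eigenvalues_nonempty n0 Ssym.
exact: le_trans (lambda_min_le Ssym Sa) (lambda_max_ge Ssym Sa).
Qed.

Lemma posdef_lambda_min_ge0 (R : realType) n (S : 'M[R]_n) :
  (0 < n)%N -> S \is symmetricmx -> posdefmx S -> 0 <= lambda_min S.
Proof.
move=> n0 Ssym Spos; apply: lb_le_inf; first exact: eigenvalues_nonempty.
by move=> a /(posdef_eigenvalue_gt0 Spos)/ltW.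
Qed.

Lemma posdef_lambda_max_gt0 (R : realType) n (S : 'M[R]_n) :
  (0 < n)%N -> S \is symmetricmx -> posdefmx S -> 0 < lambda_max S.
Proof.
move=> n0 Ssym Spos; have [a Sa] := eigenvalues_nonempty n0 Ssym.
exact: lt_le_trans (posdef_eigenvalue_gt0 Spos Sa) (lambda_max_ge Ssym Sa).
Qed.

Lemma opnorm2_gradient_step (R : realType) n (S : 'M[R]_n) (alpha gamma : R) :
  (0 < n)%N -> S \is symmetricmx -> 0 <= gamma ->
  gamma * (lambda_max S + lambda_min S + 2 * alpha) = 2 ->
  opnorm2 (1%:M - gamma *: (S + alpha%:M))
    <= gamma * ((lambda_max S - lambda_min S) / 2).
Proof.
move=> n0 Ssym g0 hg; have mM := lambda_min_le_max n0 Ssym.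
set M := lambda_max S in hg mM *; set m := lambda_min S in hg mM *.
have r0 : 0 <= (M - m) / 2 by lra.
(* The shift [alpha] cancels: the step matrix only sees the midpoint of the
   spectrum of [S]. *)
have -> : 1%:M - gamma *: (S + alpha%:M) = gamma *: (((M + m) / 2)%:M - S).
  apply/matrixP => i j; rewrite !mxE; case: (i == j); rewrite ?mulr1n ?mulr0n.
    by lra.
  by ring.
apply: opnorm2_le => [|x]; first exact: mulr_ge0.
rewrite -scalemxAl.
have -> : norm2 (gamma *: ((((M + m) / 2)%:M - S) *m x))
    = gamma * norm2 ((((M + m) / 2)%:M - S) *m x).
  (* Both sides are nonnegative, so comparing squares suffices. *)
  apply/eqP; rewrite -(eqrXn2 (n := 2)) ?mulr_ge0 ?norm2_ge0 //.
  rewrite exprMn !norm2_sqr mulr_sumr; apply/eqP/eq_bigr => i _.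
  by rewrite mxE exprMn.
rewrite -mulrA; apply: ler_wpM2l => //; apply: norm2_shift_le => // a Sa.
(* Every eigenvalue lies in [m, M], hence within (M - m)/2 of the midpoint. *)
have := lambda_min_le Ssym Sa; have := lambda_max_ge Ssym Sa.
by rewrite -/M -/m ler_norml => ? ?; apply/andP; split; lra.
Qed.

Theorem theorem6 (R : realType) (N : nat) (hN : (0 < N)%N)
  (p : 'I_N -> nat) (hp : forall i : 'I_N, (0 < p i)%N)
  (Q : 'M[R]_(\sum_(i < N) p i))
  (Qsym : Q \is symmetricmx)
  (Qpos : posdefmx Q)
  (Qdom : strict_block_diag_dominant Q)
  (qstar : R) (hqstar : 0 < qstar < 1)
  (q alpha gamma : 'I_N -> R)
  (hq : forall i : 'I_N,
     q i = (2 * (\sum_(j < N | j != i) opnorm2 (submxblock Q i j))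
              + lambda_max (submxblock Q i i) - lambda_min (submxblock Q i i))
           / (lambda_max (submxblock Q i i) + lambda_min (submxblock Q i i)))
  (halpha : forall i : 'I_N,
     alpha i = Num.max
       ((q i / qstar - 1)
          * ((lambda_max (submxblock Q i i) + lambda_min (submxblock Q i i)) / 2))
       0)
  (hgamma : forall i : 'I_N,
     gamma i = 2 / (lambda_max (submxblock Q i i)
                      + lambda_min (submxblock Q i i) + 2 * alpha i)) :
  convergence_parameter hN gamma
    (Q + \mxdiag_(i < N) ((alpha i)%:M : 'M[R]_(p i))) <= qstar.
Proof.
have [q0 _] := andP hqstar.
suff key i : opnorm2 (1%:M - gamma i *: submxblock
      (Q + \mxdiag_(i < N) ((alpha i)%:M : 'M[R]_(p i))) i i)
    + gamma i * offdiag_sum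
      (Q + \mxdiag_(i < N) ((alpha i)%:M : 'M[R]_(p i))) i <= qstar.
  by apply: bigmax_le => [|i _]; exact: key.
have -> : offdiag_sum (Q + \mxdiag_(i < N) ((alpha i)%:M : 'M[R]_(p i))) i
    = \sum_(j < N | j != i) opnorm2 (submxblock Q i j).
  apply: eq_bigr => j ji; rewrite submxblockD submxblock_mxdiag_neq ?addr0 //.
  by rewrite eq_sym.
rewrite submxblockD submxblock_diag.
(* Positions within block [i] have distinct global indices, so the block is a principal submatrix
   and inherits positive definiteness. *)
have Rank_inj : injective (@tagnat.Rank N p i).
  by move=> j k /(congr1 val)/eqP; rewrite tagnat.eq_Rank eqxx => /eqP/val_inj.
have Ssym : submxblock Q i i \is symmetricmx by exact: symmetric_mxsub.
have Spos : posdefmx (submxblock Q i i) by exact: posdef_mxsub.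
have m0 := posdef_lambda_min_ge0 (hp i) Ssym Spos.
have M0 := posdef_lambda_max_gt0 (hp i) Ssym Spos.
have ha := halpha i; have hg := hgamma i; have hqi := hq i.
set s := \sum_(j < N | j != i) _ in hqi *.
set M := lambda_max _ in ha hg hqi m0 M0 *.
set m := lambda_min _ in ha hg hqi m0 M0 *.
have a0 : 0 <= alpha i by rewrite ha le_max lexx orbT.
have D0 : 0 < M + m + 2 * alpha i by lra.
have g0 : 0 <= gamma i by rewrite hg divr_ge0 // ltW.
have gD : gamma i * (M + m + 2 * alpha i) = 2.
  by rewrite hg divfK // gt_eqF.
apply: le_trans (lerD (opnorm2_gradient_step (hp i) Ssym g0 gD) (lexx _)) _.
rewrite -/M -/m.
(* By definition q_i (M + m) = 2 s + M - m. *)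
have -> : gamma i * ((M - m) / 2) + gamma i * s
    = q i * (M + m) / (M + m + 2 * alpha i).
  by rewrite hg hqi; field; rewrite !gt_eqF //; lra.
rewrite ler_pdivrMr //.
(* What remains is q_i (M + m) <= q^* (M + m + 2 alpha_i). This is twice q^* times the inequality
   saying that alpha_i dominates the first argument of its maximum. *)
have : (q i / qstar - 1) * ((M + m) / 2) <= alpha i by rewrite ha le_max lexx.
rewrite -(ler_pM2l q0) => h.
have e : qstar * ((q i / qstar - 1) * ((M + m) / 2))
    = (q i - qstar) * ((M + m) / 2) by field; rewrite gt_eqF.
by rewrite e in h; lra.
Qed.
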